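(* Let $\mathcal{H}$ be a real Hilbert space with inner product $\langle\cdot,\cdot\rangle$ and norm $\|\cdot\|$, and let $\Phi:\mathcal{H}\to\mathbb{R}$ be a convex continuously differentiable function such that $\arg\min\Phi=\{x\in\mathcal{H}:\ \Phi(x)\le\Phi(y)\ \ \forall y\in\mathcal{H}\}$ is nonempty. Let $K>3$ and $t_0>0$ be real numbers, and let $x:[t_0,+\infty[\,\to\mathcal{H}$ be a solution of the second order differential equation $$x''(t)+\frac{K}{t}\,x'(t)+\nabla\Phi(x(t))=0,\qquad t\ge t_0 .$$ Then there exists $x_\infty\in\arg\min\Phi$ such that $x(t)$ converges weakly in $\mathcal{H}$ to $x_\infty$ as $t\to+\infty$. Moreover, the energy function $$W(t)=\frac12\|x'(t)\|^2+\Phi(x(t))-\min\Phi$$ satisfies $W(t)=o(t^{-2})$ as $t\to+\infty$, i.e. $\lim_{t\to+\infty}t^2W(t)=0$.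
   Context: $\nabla\Phi$ denotes the gradient of $\Phi$ with respect to the inner product of $\mathcal{H}$, and $\min\Phi$ denotes the minimum value of $\Phi$ on $\mathcal{H}$ (attained since $\arg\min\Phi\neq\emptyset$). A solution is a classical solution, i.e. a twice continuously differentiable function $x:[t_0,+\infty[\,\to\mathcal{H}$ satisfying the equation for all $t\ge t_0$ (one-sided derivatives at $t_0$). *)

(* Defs.v *)
From HB Require Import structures.
From mathcomp Require Import all_boot all_order all_algebra.
From mathcomp Require Import all_classical all_reals all_analysis.
Set Implicit Arguments.
Unset Strict Implicit.
Unset Printing Implicit Defensive.
Import Order.TTheory GRing.Theory Num.Theory.
Import numFieldNormedType.Exports.
Local Open Scope classical_set_scope.
Local Open Scope ring_scope.

Definition argmin (T : Type) (R : realType) (f : T -> R) : set T :=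
  [set x | forall y, f x <= f y].

(* Meaningful only when [argmin f] is nonempty: all minimizers share one value. *)
Definition min_value (T : pointedType) (R : realType) (f : T -> R) : R :=
  f (get (argmin f)).

Section Gradient.
Context {R : realType} {H : normedModType R}.

(* Frechet differentiability, with x |-> 'd f x continuous for the operator
   norm of the dual. *)
Definition continuously_differentiable (f : H -> R^o) : Prop :=
  (forall x, differentiable f x) /\
  (forall x (eps : R), 0 < eps ->
     \forall y \near x, forall h, `|'d f y h - 'd f x h| <= eps * `|h|).

(* The Riesz representative of 'd f x. It is unique by definiteness of the inner
   product; the default 0 is irrelevant when H is complete and f differentiable
   at x. *)
Definition gradient (ip : {dot H for idfun}) (f : H -> R^o) (x : H) : H :=
  xget 0 [set g | forall h, 'd f x h = ip g h].

End Gradient.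

(* Derivatives relative to a subset D of the line: ordinary at interior points
   of D, one-sided at its endpoints. Only the values of f on D matter at points
   of D. *)
Section DerivativeWithin.
Context {R : realType} {V : normedModType R}.
Implicit Types (D : set R) (f : R -> V) (t : R).

Definition diff_quotient f t : R -> V := fun s => (s - t)^-1 *: (f s - f t).

Definition derivable_in D f t : Prop :=
  cvg (diff_quotient f t @ within D t^').

Definition derive_in D f : R -> V :=
  fun t => lim (diff_quotient f t @ within D t^').

Definition C2_in D f : Prop :=
  [/\ forall t, D t -> derivable_in D f t,
      forall t, D t -> derivable_in D (derive_in D f) t &
      {within D, continuous (derive_in D (derive_in D f))}].

End DerivativeWithin.

Definition weak_cvg {R : realType} {V : normedModType R} {T : Type}
    (F : set_system T) (u : T -> V) (l : V) : Prop :=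
  forall phi : {linear V -> R^o}, continuous phi ->
    phi (u t) @[t --> F] --> phi l.

(* Main.v *)
Require Import Defs.
From HB Require Import structures.
From mathcomp Require Import all_boot all_order all_algebra.
From mathcomp Require Import all_classical all_reals all_analysis.
From mathcomp Require Import ring lra.
Import Order.TTheory GRing.Theory Num.Theory.
Import numFieldNormedType.Exports.
Local Open Scope classical_set_scope.
Local Open Scope ring_scope.

(* With lam = (K + 1) / 2 and W the mechanical energy, the function
     E(t) = t^2 W(t) + lam (t <x - z, x'> + (K - 1) / 2 |x - z|^2)
   (z a minimizer) is nonnegative and satisfies E' <= - del t W, where
   del = (K - 3) / 2. As W decreases, del (3 / 8) t^2 W(t) <= E(t / 2) - E(t),
   which tends to 0 because E converges. Hence t^2 W(t) -> 0, so
   t <x - z, x'> -> 0 and, E being convergent, |x(t) - z| converges for each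
   minimizer z. Opial's argument then gives weak convergence; weak limit points
   are taken along ultrafilters, which replaces weak sequential compactness. *)

(** * Inner product calculus: polarization, Cauchy-Schwarz, limits, product rule *)

Section InnerProduct.
Context {R : realType} {H : normedModType R} (ip : {dot H for idfun}).
Hypothesis ip_norm : forall u : H, ip u u = `|u| ^+ 2.
Implicit Types u v w : H.

Lemma ipC u v : ip u v = ip v u.
Proof. by rewrite hermC /= expr0 mul1r. Qed.

Lemma ipDl u v w : ip (u + v) w = ip u w + ip v w.
Proof. exact: linearDl. Qed.

Lemma ipDr u v w : ip w (u + v) = ip w u + ip w v.
Proof. exact: linearDr. Qed.

Lemma ipZl (a : R) u v : ip (a *: u) v = a * ip u v.
Proof. exact: linearZl_LR. Qed.

Lemma ipZr (a : R) u v : ip u (a *: v) = a * ip u v.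
Proof. exact: linearZr_LR. Qed.

Lemma ipBl u v w : ip (u - v) w = ip u w - ip v w.
Proof. exact: linearBl. Qed.

Lemma ipBr u v w : ip w (u - v) = ip w u - ip w v.
Proof. exact: linearBr. Qed.

Lemma sqnormD u v : `|u + v| ^+ 2 = `|u| ^+ 2 + 2 * ip u v + `|v| ^+ 2.
Proof. by rewrite -!ip_norm ipDl !ipDr (ipC v u); ring. Qed.

Lemma sqnormB u v : `|u - v| ^+ 2 = `|u| ^+ 2 - 2 * ip u v + `|v| ^+ 2.
Proof. by rewrite -!ip_norm ipBl !ipBr (ipC v u); ring. Qed.

Lemma ip_polar u v : ip u v = 2^-1 * (`|u + v| ^+ 2 - `|u| ^+ 2 - `|v| ^+ 2).
Proof. by rewrite sqnormD; field. Qed.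

(** Cauchy-Schwarz: polarization turns the triangle inequality of the norm into the upper bound, and
    replacing [v] by [- v] gives the lower one. *)
Lemma normr_ip_le u v : `|ip u v| <= `|u| * `|v|.
Proof.
have key w : ip u w <= `|u| * `|w|.
  rewrite ip_polar.
  have : `|u + w| ^+ 2 <= (`|u| + `|w|) ^+ 2.
    by rewrite ler_sqr ?nnegrE ?addr_ge0// ler_normD.
  lra.
have := key (- v); rewrite normrN -[- v]scaleN1r ipZr mulN1r => hN.
by rewrite ler_norml key andbT lerNl.
Qed.

(** Polarization reduces joint continuity of [ip] to continuity of the norm. *)
Lemma cvg_ip {T : Type} {F : set_system T} {FF : Filter F} (f g : T -> H) a b :
  f @ F --> a -> g @ F --> b -> ip (f t) (g t) @[t --> F] --> ip a b.
Proof.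
move=> fa gb; rewrite ip_polar.
under eq_cvg do rewrite ip_polar !expr2.
rewrite !expr2.
apply: cvgM; first exact: cvg_cst.
by apply: cvgB; [apply: cvgB|]; apply: cvgM; apply: cvg_norm => //; apply: cvgD.
Qed.

Lemma is_derive_ip (f g : R -> H) (t : R) (df dg : H) :
  is_derive t 1 f df -> is_derive t 1 g dg ->
  is_derive t 1 (fun s => ip (f s) (g s)) (ip df (g t) + ip (f t) dg).
Proof.
move=> [fd <-] [gd <-].
have gc : {for t, continuous g}.
  by apply/differentiable_continuous/derivable1_diffP.
suff L :
    h^-1 *: (ip (f (h *: 1 + t)) (g (h *: 1 + t)) - ip (f t) (g t)) @[h --> 0^']
    --> (ip ('D_1 f t) (g t) + ip (f t) ('D_1 g t) : R^o).
  by apply: DeriveDef; [apply: cvgP L | apply/cvg_lim: L].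
have Q h : h^-1 *: (ip (f (h *: 1 + t)) (g (h *: 1 + t)) - ip (f t) (g t) : R^o)
  = ip (h^-1 *: (f (h *: 1 + t) - f t)) (g (h *: 1 + t))
    + ip (f t) (h^-1 *: (g (h *: 1 + t) - g t)).
  by rewrite ipZl ipZr ipBl ipBr -mulrDr [in RHS]addrA subrK.
under eq_cvg do rewrite Q.
apply: cvgD.
  apply: cvg_ip => //.
  have : g \o (fun h : R => h *: 1 + t) @ 0^' --> g t.
    apply: continuous_cvg => //.
    rewrite -[X in _ --> X]add0r; apply: cvgD; last exact: cvg_cst.
    rewrite -[X in _ --> X](scale0r (1 : R)); apply: cvgZr_tmp.
    exact: nbhs_dnbhs.
  by [].
by apply: cvg_ip => //; exact: cvg_cst.
Qed.

Lemma is_derive_sqnorm (f : R -> H) (t : R) (df : H) :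
  is_derive t 1 f df ->
  is_derive t 1 (fun s => `|f s| ^+ 2) (2 * ip (f t) df).
Proof.
move=> fd.
have -> : (fun s => `|f s| ^+ 2) = (fun s => ip (f s) (f s)).
  by apply/funext => s; rewrite ip_norm.
have -> : 2 * ip (f t) df = ip df (f t) + ip (f t) df by rewrite (ipC df); ring.
exact: is_derive_ip.
Qed.

End InnerProduct.

(** * Limits along ultrafilters *)

Section UltraLimit.
Context {R : realType} {T : Type} {U : set_system T}.

(** Compactness of [[- M, M]] yields a cluster point. It is a limit, since an ultrafilter contains
    each set or its complement. *)
Lemma ultra_bounded_cvg (f : T -> R) (M : R) : UltraFilter U ->
  (\forall t \near U, `|f t| <= M) -> cvg (f t @[t --> U]).
Proof.
move=> UU fM.
have /(_ (f @ U)) := @segment_compact R (- M) M.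
case=> [|l [_ fl]].
  by apply: filterS fM => t; rewrite /= in_itv/= ler_norml.
apply/cvg_ex; exists l => B /= lB.
have [//|nB] := in_ultra_setVsetC (f @^-1` B) UU.
by have [y []] := fl (~` B) B nB lB.
Qed.

End UltraLimit.

(** * Riesz representation, weak limits along ultrafilters, Opial's lemma *)

Section Hilbert.
Context {R : realType} {H : completeNormedModType R} (ip : {dot H for idfun}).
Hypothesis ip_norm : forall u : H, ip u u = `|u| ^+ 2.

(* The representative is the minimizer of [|u|^2 - 2 phi u]. *)
Lemma riesz_representation (phi : H -> R) (M : R) :
  (forall a u v, phi (a *: u + v) = a * phi u + phi v) ->
  (forall u, `|phi u| <= M * `|u|) ->
  exists g, forall h, phi h = ip g h.
Proof.
move=> phi_lin phi_bnd.
pose J u := `|u| ^+ 2 - 2 * phi u.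
have phiZ a u : phi (a *: u) = a * phi u.
  have phi0 : phi 0 = 0 by have := phi_lin 1 0 0; rewrite scale1r addr0; lra.
  by have := phi_lin a u 0; rewrite !addr0 phi0 addr0.
have phiD u v : phi (u + v) = phi u + phi v.
  by have := phi_lin 1 u v; rewrite scale1r mul1r.
have J_inf : has_inf (range J).
  split; first by exists (J 0); exists 0.
  (* Completing the square: [J u] is at least [|u|^2 - 2 M |u| = (|u| - M)^2 - M^2]. *)
  exists (- M ^+ 2) => _ [u _ <-]; rewrite /J.
  have := phi_bnd u; rewrite ler_norml => /andP[_].
  have := sqr_ge0 (`|u| - M).
  nra.
pose m := inf (range J).
have J_ge u : m <= J u by apply: ge_inf; [case: J_inf|exists u].
(* Parallelogram identity with [J >= m] at the midpoint; the linear parts cancel. Minimizing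
   sequences are therefore Cauchy. *)
have parallelogram u v : `|u - v| ^+ 2 <= 2 * (J u - m) + 2 * (J v - m).
  have := J_ge (2^-1 *: (u + v)).
  rewrite /J phiZ phiD normrZ exprMn gtr0_norm ?invr_gt0//.
  rewrite (sqnormD _ ip_norm) (sqnormB _ ip_norm).
  lra.
have /choice[u Ju] : forall n, exists u, J u < m + n.+1%:R^-1.
  move=> n; have [_ [u _ <-] Ju] :=
    inf_adherent (harmonic_gt0 n : 0 < harmonic n :> R) J_inf.
  by exists u.
have u_cvg : cvg (u n @[n --> \oo]).
  apply/cauchy_cvgP/cauchy_exP => e e0.
  (* With both excesses over [m] below [e^2 / 8], the bound above gives
     [|u N - u n|^2 < e^2 / 2]. *)
  have e8 : 0 < e ^+ 2 / 8 by rewrite divr_gt0// exprn_gt0.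
  have small : \forall n \near \oo, n.+1%:R^-1 < e ^+ 2 / 8.
    exact: (cvgr_lt (0 : R) cvg_harmonic).
  have [N HN] := filter_ex small.
  exists (u N); suff: \forall n \near \oo, ball (u N) e (u n) by [].
  apply: filterS small => n Hn; rewrite -ball_normE /=.
  rewrite -(ltr_pXn2r (_ : (0 < 2)%N)) ?nnegrE// ?ltW//.
  have := parallelogram (u N) (u n); have := Ju N; have := Ju n.
  move: HN Hn e8; set a := N.+1%:R^-1; set b := n.+1%:R^-1.
  lra.
pose g := lim (u n @[n --> \oo]).
have J_cvg : J (u n) @[n --> \oo] --> J g.
  apply: cvgB; first by rewrite !expr2; apply: cvgM; apply: cvg_norm.
  apply: cvgM; first exact: cvg_cst.
  apply/subr_cvg0/norm_cvg0P.
  apply: (@squeeze_cvgr _ _ _ _ (cst 0) (fun n => M * `|u n - g|)).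
  - near=> n; rewrite /= normr_ge0 /=.
    by rewrite -[_ - _](addrC (- _)) -[- _]mulN1r -phiZ scaleN1r -phiD addrC.
  - exact: cvg_cst.
  - rewrite -[X in _ --> X](mulr0 M); apply: cvgM; first exact: cvg_cst.
    by apply/norm_cvg0P/subr_cvg0.
have Jg : J g <= m.
  have : m + harmonic n @[n --> \oo] --> m + 0.
    by apply: cvgD; [exact: cvg_cst|exact: cvg_harmonic].
  rewrite addr0 => /(ler_cvg_to J_cvg); apply.
  by near=> n; rewrite ltW.
exists g => h.
have variation s : 0 <= s ^+ 2 * `|h| ^+ 2 + 2 * s * (ip g h - phi h).
  have := le_trans Jg (J_ge (g + s *: h)).
  rewrite /J (sqnormD _ ip_norm) phiD phiZ ipZr normrZ exprMn.
  rewrite real_normK ?num_real//; lra.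
set d := ip g h - phi h in variation.
suff : d = 0 by rewrite /d; lra.
have c1 : 0 < `|h| ^+ 2 + 1 by rewrite ltr_wpDl// exprn_ge0.
(* A value of [s] making the quadratic nonpositive, which forces [d = 0]; the [+ 1] keeps the
   denominator positive when [h = 0]. *)
have := variation (- d / (`|h| ^+ 2 + 1)).
set c := `|h| ^+ 2 in c1 *.
rewrite [X in 0 <= X](_ : _ = - (d ^+ 2 * (c + 2) / (c + 1) ^+ 2)); last first.
  by field; rewrite gt_eqF.
rewrite oppr_ge0 pmulr_lle0 ?invr_gt0 ?exprn_gt0// pmulr_lle0; last lra.
by move=> d0; apply/eqP; rewrite -sqrf_eq0 eq_le d0 sqr_ge0.
Unshelve. all: by end_near. Qed.

Lemma continuous_riesz (phi : {linear H -> R^o}) : continuous phi ->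
  exists g, forall h, phi h = ip g h.
Proof.
move=> phi_cont.
have /linear_boundedP := continuous_linear_bounded 0 (phi_cont 0).
move=> /filter_ex[M phiM].
exact: (@riesz_representation phi M (linearP phi)).
Qed.

(** Weak compactness of balls: each bounded scalar [ip h (u t)] has a limit along [U], this limit is
    a bounded linear function of [h], and Riesz represents it by some [z]. *)
Lemma ultra_weak_cvg {T : Type} (U : set_system T) (u : T -> H) (M : R) :
  UltraFilter U -> (\forall t \near U, `|u t| <= M) ->
  exists z, forall h, ip h (u t) @[t --> U] --> ip h z.
Proof.
move=> UU uM.
have bnd h : \forall t \near U, `|ip h (u t)| <= `|h| * M.
  apply: filterS uM => t uM.
  by rewrite (le_trans (normr_ip_le _ ip_norm _ _))// ler_wpM2l.
have ipU h : cvg (ip h (u t) @[t --> U]) := ultra_bounded_cvg _ _ UU (bnd h).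
pose phi h := lim (ip h (u t) @[t --> U]).
have [||z phiE] := @riesz_representation phi M.
- move=> a v w; apply/cvg_lim => //.
  under eq_cvg do rewrite ipDl ipZl.
  apply: cvgD; last exact: ipU.
  by apply: cvgM; [exact: cvg_cst|exact: ipU].
- move=> h; rewrite mulrC.
  apply: cvgr_to_le (bnd h).
  by apply: cvg_norm; exact: ipU.
by exists z => h; rewrite ipC -phiE; exact: ipU.
Qed.

(** All ultrafilters finer than [F] share one weak limit, because convergence of the distances to
    two weak limits in [S] forces them to coincide. A failure of weak convergence along [F] would
    survive along some finer ultrafilter. *)
Lemma opial {T : Type} (F : set_system T) (u : T -> H) (S : set H) :
  ProperFilter F -> S !=set0 ->
  (forall z, S z -> cvg (`|u t - z| ^+ 2 @[t --> F])) ->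
  (forall (U : set_system T) z, UltraFilter U -> F `<=` U ->
     (forall h, ip h (u t) @[t --> U] --> ip h z) -> S z) ->
  exists2 z, S z & weak_cvg F u z.
Proof.
move=> FF [z0 Sz0] norm_cvg limS.
have [M uM] : exists M, \forall t \near F, `|u t| <= M.
  have [l ul] : exists l : R, `|u t - z0| ^+ 2 @[t --> F] --> l.
    by exists (lim (`|u t - z0| ^+ 2 @[t --> F])); exact: norm_cvg.
  (* From [a <= (a^2 + 1) / 2] with [a = |u t - z0|] and eventually [a^2 <= l + 1]. *)
  exists (2^-1 * (l + 2) + `|z0|).
  have : \forall t \near F, `|u t - z0| ^+ 2 <= l + 1.
    by apply: (cvgr_le _ ul); rewrite ltrDl.
  apply: filterS => t ut.
  have := ler_normD (u t - z0) z0; rewrite subrK.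
  by have := sqr_ge0 (`|u t - z0| - 1); lra.
have ultra_lim (U : set_system T) : UltraFilter U -> F `<=` U ->
    exists2 z, S z & forall h, ip h (u t) @[t --> U] --> ip h z.
  move=> UU FU; have [z uz] := ultra_weak_cvg _ _ _ UU (FU _ uM).
  by exists z => //; exact: limS uz.
have [U0 [U0U FU0]] := ultraFilterLemma FF.
have [z Sz uz] := ultra_lim _ U0U FU0.
have uniq (U : set_system T) w : UltraFilter U -> F `<=` U -> S w ->
    (forall h, ip h (u t) @[t --> U] --> ip h w) -> w = z.
  move=> UU FU Sw uw.
  (* [|u - z|^2 - |u - w|^2] is affine in [<w - z, u>] *)
  have [l ul] : exists l : R, ip (w - z) (u t) @[t --> F] --> l.
    exists (2^-1 * (lim (`|u t - z| ^+ 2 @[t --> F])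
      - lim (`|u t - w| ^+ 2 @[t --> F]) + (`|w| ^+ 2 - `|z| ^+ 2))).
    have E t : ip (w - z) (u t) =
        2^-1 * (`|u t - z| ^+ 2 - `|u t - w| ^+ 2 + (`|w| ^+ 2 - `|z| ^+ 2)).
      by rewrite !(sqnormB _ ip_norm) ipBl (ipC _ w) (ipC _ z); field.
    under eq_cvg do rewrite E.
    apply: cvgM; first exact: cvg_cst.
    apply: cvgD; last exact: cvg_cst.
    by apply: cvgB; exact: norm_cvg.
  have lw : l = ip (w - z) w.
    by apply: (cvg_unique _ (cvg_trans (cvg_app _ FU) ul) (uw _)).
  have lz : l = ip (w - z) z.
    by apply: (cvg_unique _ (cvg_trans (cvg_app _ FU0) ul) (uz _)).
  apply/subr0_eq/normr0_eq0/eqP; rewrite -sqrf_eq0 -ip_norm ipBr -lw -lz.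
  by rewrite subrr.
exists z => // phi /continuous_riesz[g phiE].
rewrite phiE; under eq_cvg do rewrite phiE.
move=> B zB; apply: contrapT => nB.
(* As [B] fails to hold eventually, [F] restricted to the bad set [A] is proper, so it extends to an
   ultrafilter that contains [A]. *)
pose A := (fun t => ip g (u t)) @^-1` (~` B).
have GP : ProperFilter (within A F).
  split => [AF|]; last exact: within_filter.
  apply: nB; suff : F ((fun t => ip g (u t)) @^-1` B) by [].
  have {}AF : F (fun t => A t -> False) := AF.
  by apply: filterS AF => t /= nA; apply: contrapT => /nA.
have [U [UU AFU]] := ultraFilterLemma GP.
have FU : F `<=` U by apply: subset_trans AFU; exact: cvg_within.
have [w Sw uw] := ultra_lim _ UU FU.
have UA : U A by apply: AFU; exact: withinT.
have UB : U ((fun t => ip g (u t)) @^-1` B).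
  by apply: (uw g); rewrite (uniq _ _ UU FU Sw uw).
have : U set0 by apply: filterS (filterI UA UB) => t [].
exact: filter_not_empty.
Unshelve. all: by end_near. Qed.

End Hilbert.

(** * Monotonicity and limits of real functions *)

Section RealAnalysis.
Context {R : realType}.

Lemma is_derive_le0_nincr (f df : R -> R) (a b : R) : a <= b ->
  (forall t, a <= t <= b -> is_derive t 1 f (df t)) ->
  (forall t, a <= t <= b -> df t <= 0) -> f b <= f a.
Proof.
move=> ab f_df df_le0.
have itv t : t \in `]a, b[ -> a <= t <= b.
  by rewrite in_itv/= => /andP[/ltW-> /ltW->].
apply: (@ler0_derive1_nincr _ f a b) => // [t /itv tab|t /itv tab|].
- by have [] := f_df _ tab.
- by rewrite derive1E; have [_ ->] := f_df _ tab; exact: df_le0.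
- apply: derivable_within_continuous => t; rewrite in_itv/= => tab.
  by have [] := f_df _ tab.
Qed.

Lemma nonincreasing_is_cvg_pinfty (f : R -> R) (a b : R) :
  (forall s t, a < s -> s <= t -> f t <= f s) ->
  (forall t, a < t -> b <= f t) -> cvg (f t @[t --> +oo]).
Proof.
move=> f_nincr f_ge.
pose A := f @` [set t | a < t].
have A_inf : has_inf A.
  split; first by exists (f (a + 1)), (a + 1) => //=; rewrite ltrDl.
  by exists b => _ [t at_ <-]; exact: f_ge.
apply: (@cvgP _ _ (inf A : R)); apply/cvgrPdist_le => e e0.
have [_ [s a_s <-] fs] := inf_adherent e0 A_inf.
near=> t.
have st : s <= t by near: t; exact: nbhs_pinfty_ge (num_real _).
have inf_le : inf A <= f t.
  by apply: ge_inf; [case: A_inf|exists t => //=; exact: lt_le_trans a_s st].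
rewrite distrC ger0_norm ?subr_ge0// lerBlDl.
exact: le_trans (f_nincr _ _ a_s st) (ltW fs).
Unshelve. all: by end_near. Qed.

Lemma cvg_sqr0 {T : Type} {F : set_system T} {FF : Filter F} (f : T -> R) :
  f t ^+ 2 @[t --> F] --> 0 -> f t @[t --> F] --> 0.
Proof.
move=> f0; apply/cvgrPdist_lt => e e0.
near=> t; rewrite sub0r normrN.
rewrite -(ltr_pXn2r (_ : (0 < 2)%N)) ?nnegrE// ?ltW// real_normK ?num_real//.
by near: t; apply: (cvgr_lt _ f0); rewrite exprn_gt0.
Unshelve. all: by end_near. Qed.

End RealAnalysis.

(** * Derivatives within a set, chain rule, subgradient inequality, gradient *)

Section Differential.
Context {R : realType} {V : normedModType R}.

(** Near an interior point the restriction to [D] is vacuous; the shift [s = h + t] matches the two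
    difference quotients. *)
Lemma is_derive_in (D : set R) (f : R -> V) (t : R) :
  nbhs t D -> derivable_in D f t -> is_derive t 1 f (derive_in D f t).
Proof.
move=> Dt ft.
have shift_cvg : h *: (1 : R) + t @[h --> (0 : R)^'] --> within D t^'.
  move=> P DP.
  have {}DP : \forall s \near t, s != t -> P s.
    move: (DP : \forall s \near t, s != t -> D s -> P s) => DP'.
    by near=> s => st; apply: (near DP' s _ _) => //; apply: (near Dt s _).
  have c : h *: (1 : R) + t @[h --> (0 : R)] --> t.
    rewrite -[X in _ --> X]add0r; apply: cvgD; last exact: cvg_cst.
    by rewrite -[X in _ --> X](scale0r (1 : R)); apply: cvgZr_tmp.
  suff: \forall h \near (0 : R), h != 0 -> P (h *: (1 : R) + t) by [].
  have {}DP : \forall h \near (0 : R), h *: (1 : R) + t != t ->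
    P (h *: (1 : R) + t) := c _ DP.
  near=> h => h0; apply: (near DP h) => //.
  by rewrite -subr_eq0 addrK [_ *: _]mulr1.
have L : h^-1 *: (f (h *: 1 + t) - f t) @[h --> 0^'] --> derive_in D f t.
  have -> : (fun h => h^-1 *: (f (h *: (1 : R) + t) - f t)) =
      diff_quotient f t \o (fun h => h *: (1 : R) + t).
    by apply/funext => h; rewrite /diff_quotient /= addrK [h *: 1]mulr1.
  exact: cvg_comp shift_cvg ft.
by apply: DeriveDef; [apply: cvgP L | apply/cvg_lim: L].
Unshelve. all: by end_near. Qed.

Lemma is_derive_comp_diff {W : normedModType R} (f : V -> W) (u : R -> V)
    (t : R) (du : V) :
  differentiable f (u t) -> is_derive t 1 u du ->
  is_derive t 1 (fun s => f (u s)) ('d f (u t) du).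
Proof.
move=> fd [ud <-].
have ud' : differentiable u t by apply/derivable1_diffP.
have fu : differentiable (f \o u) t by exact: differentiable_comp.
apply: DeriveDef; first exact/diff_derivable.
by rewrite !deriveE// -[LHS]/('d (f \o u) t 1) diff_comp.
Qed.

(** By convexity the difference quotient at [u] towards [v] is at most [f v - f u] for steps
    [0 < h <= 1]; let [h] tend to 0 from the right. *)
Lemma convex_differential_le (f : V -> R^o) (u v : V) :
  convex_function setT f -> differentiable f u -> f u + 'd f u (v - u) <= f v.
Proof.
move=> f_convex fd.
rewrite -deriveE// addrC -lerBrDr.
have D : h^-1 *: (f (h *: (v - u) + u) - f u) @[h --> 0^'+] --> 'D_(v - u) f u.
  apply: (cvg_dnbhs_at_right
    (f := fun h => h^-1 *: (f (h *: (v - u) + u) - f u))).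
  exact: diff_derivable.
apply: cvgr_to_le D _.
near=> h.
have h0 : 0 < h by near: h; exact: nbhs_right_gt.
have h1 : h <= 1 by near: h; exact: nbhs_right_le.
have := f_convex (Itv01 (ltW h0) h1) v u; rewrite !inE => /(_ Logic.I Logic.I).
rewrite convRE /= => cvx.
have -> : h *: (v - u) + u = h *: v + (1 - h) *: u.
  by rewrite scalerBr scalerBl scale1r addrAC addrA.
rewrite -[X in X <= _]/(h^-1 * (_ - _)) mulrC ler_pdivrMr//.
apply: le_trans (lerB cvx (lexx _)) _.
by rewrite /unstable.onem; lra.
Unshelve. all: by end_near. Qed.

End Differential.

(** Riesz makes the set of representatives nonempty, so the default 0 of [xget] is not taken. *)
Lemma gradientE {R : realType} {H : completeNormedModType R}
    (ip : {dot H for idfun}) (f : H -> R^o) (u h : H) :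
  (forall v : H, ip v v = `|v| ^+ 2) -> differentiable f u ->
  'd f u h = ip (gradient ip f u) h.
Proof.
move=> ip_norm fd.
have /(xgetPex 0) : exists g, forall h, 'd f u h = ip g h.
  by apply: continuous_riesz => //; exact: diff_continuous.
exact.
Qed.

(** * Energy estimates along the trajectory *)

Section Dynamics.
Context {R : realType} {H : normedModType R} (ip : {dot H for idfun}).
Hypothesis ip_norm : forall u : H, ip u u = `|u| ^+ 2.
Variables (Phi : H -> R^o) (grad : H -> H) (m K t0 : R) (x dx ddx : R -> H).
Hypothesis Phi_ge : forall u, m <= Phi u.
Hypothesis Phi_subgrad : forall u v, Phi u + ip (grad u) (v - u) <= Phi v.
Hypotheses (K_gt3 : 3 < K) (t0_gt0 : 0 < t0).
Hypothesis x_dx : forall t, t0 < t -> is_derive t 1 x (dx t).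
Hypothesis dx_ddx : forall t, t0 < t -> is_derive t 1 dx (ddx t).
Hypothesis Phi_x : forall t, t0 < t ->
  is_derive t 1 (fun s => Phi (x s) : R) (ip (grad (x t)) (dx t)).
Hypothesis x_sol : forall t, t0 < t ->
  ddx t + (K / t) *: dx t + grad (x t) = 0.

Let ddxE t : t0 < t -> ddx t = (- (K / t)) *: dx t - grad (x t).
Proof.
by move=> /x_sol/eqP; rewrite addr_eq0 scaleNr => /eqP<-; rewrite addrC addrK.
Qed.

Definition mech_energy (t : R) : R := 2^-1 * `|dx t| ^+ 2 + Phi (x t) - m.
Local Notation W := mech_energy.

Lemma mech_energy_ge0 t : 0 <= W t.
Proof. by have := Phi_ge (x t); have := sqr_ge0 `|dx t|; rewrite /W; lra. Qed.

(** Substituting the equation for [ddx] cancels the gradient terms; only friction remains. *)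
Lemma is_derive_mech_energy t : t0 < t ->
  is_derive t 1 W (- (K / t) * `|dx t| ^+ 2).
Proof.
move=> t0t.
have D : is_derive t 1
    (2^-1 \*: (fun s => `|dx s| ^+ 2 : R^o) + (fun s => Phi (x s)) - cst m) _
  := is_deriveB (is_deriveD
       (is_deriveZ 2^-1 (is_derive_sqnorm _ ip_norm _ _ _ (dx_ddx _ t0t)))
       (Phi_x _ t0t)) (is_derive_cst m t 1).
apply: (is_derive_eq D).
rewrite ddxE// ipBr ipZr ip_norm (ipC ip (grad _)) /GRing.scale/=.
by rewrite subr0 mulKf ?pnatr_eq0// subrK.
Qed.

(* With [lam = (K + 1) / 2] both coefficients in the energy estimate,
   [lam - 2] and [K - 1 - lam], equal [(K - 3) / 2]. *)
Let lam : R := (K + 1) / 2.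
Let del : R := (K - 3) / 2.

Definition anchored_energy (z : H) (t : R) : R :=
  t ^+ 2 * W t +
  lam * (t * ip (x t - z) (dx t) + (K - 1) / 2 * `|x t - z| ^+ 2).
Local Notation E := anchored_energy.

Let dE (z : H) (t : R) : R :=
  2 * t * (Phi (x t) - m) - lam * t * ip (grad (x t)) (x t - z)
  - del * t * `|dx t| ^+ 2.

(** The weight [(K - 1) / 2] in [E] is the one for which the terms in [ip (x t - z) (dx t)]
    cancel. *)
Lemma is_derive_anchored_energy z t : t0 < t -> is_derive t 1 (E z) (dE z t).
Proof.
move=> t0t.
have t_neq0 : t != 0 by rewrite gt_eqF// (lt_trans t0_gt0).
have xz : is_derive t 1 (fun s => x s - z) (dx t).
  have := is_deriveB (x_dx _ t0t) (is_derive_cst z t 1).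
  by rewrite subr0.
have D : is_derive t 1
    ((@id R) ^+ 2 * W + lam \*: ((@id R) * (fun s => ip (x s - z) (dx s))
       + ((K - 1) / 2) \*: (fun s => `|x s - z| ^+ 2 : R^o)))
    _
  := is_deriveD
    (is_deriveM (is_deriveX 2 (is_derive_id t 1)) (is_derive_mech_energy _ t0t))
    (is_deriveZ lam (is_deriveD
      (is_deriveM (is_derive_id t 1)
         (is_derive_ip _ ip_norm _ _ _ _ _ xz (dx_ddx _ t0t)))
      (is_deriveZ ((K - 1) / 2) (is_derive_sqnorm _ ip_norm _ _ _ xz)))).
apply: (is_derive_eq D).
rewrite /dE ddxE// [ip (x t - z) (_ *: _ - _)]ipBr ipZr ip_norm.
rewrite (ipC ip (grad _)) /GRing.scale/=.
rewrite (_ : (id ^+ 2) t = t ^+ 2)// /W /lam /del.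
set X := ip (x t - z) (grad (x t)); set Y := ip (x t - z) (dx t).
set P : R := Phi (x t); set V := `|dx t|.
by field.
Qed.

(** Completing the square in [t *: dx t] exhibits [E] as a sum of nonnegative terms; the remainder
    uses [K - 1 - lam = del]. *)
Lemma anchored_energyE z t : E z t =
  t ^+ 2 * (Phi (x t) - m) + 2^-1 * `|lam *: (x t - z) + t *: dx t| ^+ 2
  + 2^-1 * lam * del * `|x t - z| ^+ 2.
Proof.
rewrite (sqnormD _ ip_norm (lam *: _)) !normrZ !exprMn.
rewrite !real_normK ?num_real// ipZl ipZr /E /W /lam /del.
set P : R := Phi (x t); set Q := `|x t - z|.
by field.
Qed.

Lemma anchored_energy_ge z t :
  2^-1 * lam * del * `|x t - z| ^+ 2 <= E z t.
Proof.
rewrite anchored_energyE lerDr; apply: addr_ge0; apply: mulr_ge0.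
- exact: sqr_ge0.
- by rewrite subr_ge0.
- by rewrite invr_ge0.
- exact: sqr_ge0.
Qed.

Let lam_gt0 : 0 < lam.
Proof. by rewrite /lam; have := K_gt3; lra. Qed.

Let del_gt0 : 0 < del.
Proof. by rewrite /del; have := K_gt3; lra. Qed.

Let coef_gt0 : 0 < 2^-1 * lam * del.
Proof. by apply: mulr_gt0 => //; apply: mulr_gt0 => //; rewrite invr_gt0. Qed.

Lemma mech_energy_nincr s t : t0 < s -> s <= t -> W t <= W s.
Proof.
move=> t0s st.
apply: (@is_derive_le0_nincr R W (fun r => - (K / r) * `|dx r| ^+ 2) _ _ st)
  => r /andP[sr _].
  by apply: is_derive_mech_energy; exact: lt_le_trans sr.
have r0 : 0 < r by apply: lt_le_trans sr; exact: lt_trans t0s.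
rewrite mulNr oppr_le0 mulr_ge0 ?exprn_ge0// divr_ge0 ?ltW//.
exact: lt_trans K_gt3.
Qed.

(** The subgradient inequality tested at [z], times [lam * t], leaves [(2 - lam) t = - del t] in
    front of [Phi (x t) - m]. Half of the kinetic term is then discarded. *)
Lemma derive_anchored_energy_le z t : m = Phi z -> t0 < t ->
  dE z t <= - (del * t * W t).
Proof.
move=> mE t0t.
have t_gt0 : 0 < t := lt_trans t0_gt0 t0t.
have sub : Phi (x t) - m <= ip (grad (x t)) (x t - z).
  have := Phi_subgrad (x t) z; rewrite -(opprB (x t)) -scaleN1r ipZr -mE.
  by move: (Phi _ : R) => P; lra.
have := ler_wpM2l (ltW (mulr_gt0 lam_gt0 t_gt0)) sub.
have := mulr_ge0 (ltW (mulr_gt0 del_gt0 t_gt0)) (sqr_ge0 `|dx t|).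
rewrite /dE /W /del /lam.
set P : R := Phi (x t); set Q := ip (grad (x t)) (x t - z); set V := `|dx t|.
move=> h1 h2.
lra.
Qed.

Section Minimizer.
Variable z : H.
Hypothesis z_min : m = Phi z.

Lemma anchored_energy_nincr s t : t0 < s -> s <= t -> E z t <= E z s.
Proof.
move=> t0s st.
apply: (@is_derive_le0_nincr R (E z) (dE z) _ _ st) => r /andP[sr _].
  by apply: is_derive_anchored_energy; exact: lt_le_trans sr.
have t0r : t0 < r := lt_le_trans t0s sr.
apply: le_trans (derive_anchored_energy_le _ _ z_min t0r) _.
rewrite oppr_le0 mulr_ge0 ?mech_energy_ge0// mulr_ge0 ?ltW//.
exact: lt_trans t0r.
Qed.

Lemma anchored_energy_is_cvg : cvg (E z t @[t --> +oo]).
Proof.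
apply: (@nonincreasing_is_cvg_pinfty _ _ t0 0) => [|t _].
  exact: anchored_energy_nincr.
apply: le_trans (anchored_energy_ge z t).
by apply: mulr_ge0; [exact: ltW|exact: sqr_ge0].
Qed.

(* Since [W] decreases, integrating [E' <= - del s W(s)] over [t/2, t]
   bounds [t^2 W(t)] by a decrement of the convergent [E]. *)
Lemma mech_energy_le t : 2 * t0 < t ->
  t ^+ 2 * W t <= 8 / (3 * del) * (E z (2^-1 * t) - E z t).
Proof.
move=> t0t.
have t2t : 2^-1 * t <= t by have := t0_gt0; lra.
have t0t2 : t0 < 2^-1 * t by lra.
(* With this [q], [q * s ^+ 2] has derivative [del * s * W t], at most [del * s * W s] for [s <= t],
   so adding it to [E] keeps the sum nonincreasing. Its increment over [[t/2, t]] is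
   [(3 / 8) del t^2 W(t)]. *)
pose q : R := del * W t / 2.
have h : E z t + q * t ^+ 2 <= E z (2^-1 * t) + q * (2^-1 * t) ^+ 2.
  apply: (@is_derive_le0_nincr R (fun s => E z s + q * s ^+ 2)
    (fun s => dE z s + q * (2 * s)) _ _ t2t) => s /andP[ts st].
    have t0s : t0 < s := lt_le_trans t0t2 ts.
    have D := is_deriveD (is_derive_anchored_energy z _ t0s)
      (is_deriveZ q (is_deriveX 2 (is_derive_id s 1))).
    apply: (is_derive_eq D).
    by rewrite /GRing.scale/= expr1 mulr1.
  have t0s : t0 < s := lt_le_trans t0t2 ts.
  have := derive_anchored_energy_le _ _ z_min t0s.
  have : del * s * W t <= del * s * W s.
    rewrite ler_wpM2l ?mech_energy_nincr// mulr_ge0 ?ltW//.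
    exact: lt_trans t0s.
  rewrite /q; set w := W t; set v := W s; set A := dE z s.
  lra.
rewrite [X in _ <= X]mulrAC ler_pdivlMr; last exact: mulr_gt0.
move: h; rewrite /q; set w := W t; set a := E z t; set b := E z _.
lra.
Qed.

Lemma mech_energy_cvg : t ^+ 2 * W t @[t --> +oo] --> (0 : R).
Proof.
pose l : R := lim (E z t @[t --> +oo]).
have El : E z t @[t --> +oo] --> l := anchored_energy_is_cvg.
have El2 : E z (2^-1 * t) @[t --> +oo] --> l.
  apply: cvg_comp El.
  apply/cvgryPge => A; near=> t.
  have : 2 * A <= t by near: t; exact: nbhs_pinfty_ge (num_real _).
  lra.
apply: (@squeeze_cvgr _ _ _ _ (cst 0)
  (fun t => 8 / (3 * del) * (E z (2^-1 * t) - E z t))).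
- near=> t; rewrite /= mulr_ge0 ?sqr_ge0 ?mech_energy_ge0//=.
  by apply: mech_energy_le; near: t; exact: nbhs_pinfty_gt (num_real _).
- exact: cvg_cst.
- rewrite -[X in _ --> X](mulr0 (8 / (3 * del))) -(subrr l).
  by apply: cvgM; [exact: cvg_cst|exact: cvgB].
Unshelve. all: by end_near. Qed.

Lemma Phi_cvg : Phi (x t) @[t --> +oo] --> (m : R).
Proof.
apply/subr_cvg0.
apply: (@squeeze_cvgr _ _ _ _ (cst 0) (fun t => t ^+ 2 * W t)).
- near=> t; rewrite /= subr_ge0 Phi_ge /=.
  have t1 : 1 <= t by near: t; exact: nbhs_pinfty_ge (num_real _).
  have W1 : Phi (x t) - m <= W t.
    by have := sqr_ge0 `|dx t|; rewrite /W; move: (Phi _ : R) => P; lra.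
  apply: le_trans W1 _; rewrite ler_peMl ?mech_energy_ge0//.
  by rewrite expr_ge1 // (le_trans _ t1).
- exact: cvg_cst.
- exact: mech_energy_cvg.
Unshelve. all: by end_near. Qed.

(** By Cauchy-Schwarz the square is at most [|x t - z|^2] times [t^2 |dx t|^2]: the first factor is
    bounded through [E], the second is at most [2 t^2 W(t)]. *)
Lemma mixed_term_cvg : t * ip (x t - z) (dx t) @[t --> +oo] --> (0 : R).
Proof.
apply: cvg_sqr0.
(* The base time [t0 + 1] is used because [E] is known to decrease only strictly after [t0]. *)
pose b := E z (t0 + 1) / (2^-1 * lam * del).
apply: (@squeeze_cvgr _ _ _ _ (cst 0) (fun t => b * (2 * (t ^+ 2 * W t)))).
- near=> t; rewrite /= sqr_ge0 /=.
  have t1 : t0 + 1 <= t by near: t; exact: nbhs_pinfty_ge (num_real _).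
  have xz_le : `|x t - z| ^+ 2 <= b.
    rewrite ler_pdivlMr// mulrC.
    apply: le_trans (anchored_energy_ge z t) _.
    by apply: anchored_energy_nincr t1; rewrite ltrDl.
  have dx_le : t ^+ 2 * `|dx t| ^+ 2 <= 2 * (t ^+ 2 * W t).
    rewrite [X in _ <= X]mulrCA ler_wpM2l ?sqr_ge0//.
    by have := Phi_ge (x t); rewrite /W; move: (Phi _ : R) => P; lra.
  apply: le_trans (ler_pM _ _ xz_le dx_le); rewrite ?mulr_ge0 ?sqr_ge0//.
  rewrite exprMn [X in _ <= X]mulrCA ler_wpM2l ?sqr_ge0// -exprMn.
  rewrite -real_normK ?num_real//.
  by rewrite ler_sqr ?nnegrE ?mulr_ge0// normr_ip_le.
- exact: cvg_cst.
- rewrite -[X in _ --> X](mulr0 b) -[X in b * X](mulr0 2).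
  apply: cvgM; first exact: cvg_cst.
  by apply: cvgM; [exact: cvg_cst|exact: mech_energy_cvg].
Unshelve. all: by end_near. Qed.

Lemma dist_minimizer_is_cvg : cvg (`|x t - z| ^+ 2 @[t --> +oo]).
Proof.
pose l : R := lim (E z t @[t --> +oo]).
have El : E z t @[t --> +oo] --> l := anchored_energy_is_cvg.
apply: (@cvgP _ _ (2 / (lam * (K - 1)) * (l - 0 - lam * 0))).
have xzE t : `|x t - z| ^+ 2 = 2 / (lam * (K - 1)) *
    (E z t - t ^+ 2 * W t - lam * (t * ip (x t - z) (dx t))).
  rewrite /E; field.
  by have := K_gt3; have := lam_gt0; lra.
under eq_cvg do rewrite xzE.
apply: cvgM; first exact: cvg_cst.
apply: cvgB; first by apply: cvgB => //; exact: mech_energy_cvg.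
by apply: cvgM; [exact: cvg_cst|exact: mixed_term_cvg].
Qed.

End Minimizer.

(** Weak lower semicontinuity: the subgradient minorant at [w] is affine, hence passes to the weak
    limit, where it equals [Phi w]. *)
Lemma weak_limit_minimizer {T : topologicalType} (U : set_system T)
    (u : T -> H) (w : H) :
  ProperFilter U -> Phi (u t) @[t --> U] --> (m : R) ->
  (forall h, ip h (u t) @[t --> U] --> ip h w) -> Phi w <= m.
Proof.
move=> UP Phi_u uw.
have L : Phi w + (ip (grad w) (u t) - ip (grad w) w) @[t --> U] -->
    (Phi w + (ip (grad w) w - ip (grad w) w) : R).
  by apply: cvgD; [exact: cvg_cst|apply: cvgB; [exact: uw|exact: cvg_cst]].
rewrite subrr addr0 in L.
apply: (ler_cvg_to L Phi_u).
apply: filterE => t.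
by rewrite -ipBr; exact: Phi_subgrad.
Qed.

End Dynamics.

Theorem theorem1p2 (R : realType) (H : completeNormedModType R)
    (ip : {dot H for idfun}) (ip_norm : forall u : H, ip u u = `|u| ^+ 2)
    (Phi : H -> R^o)
    (Phi_convex : convex_function setT Phi)
    (Phi_C1 : continuously_differentiable Phi)
    (Phi_argmin : argmin Phi !=set0)
    (K t0 : R) (K_gt3 : 3 < K) (t0_gt0 : 0 < t0)
    (x : R -> H)
    (I := [set t : R | t0 <= t])
    (x' := derive_in I x)
    (x'' := derive_in I x')
    (x_C2 : C2_in I x)
    (x_sol : forall t, t0 <= t ->
       x'' t + (K / t) *: x' t + gradient ip Phi (x t) = 0)
    (W := fun t : R => 2^-1 * `|x' t| ^+ 2 + Phi (x t) - min_value Phi) :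
  (exists2 x_oo : H, argmin Phi x_oo & weak_cvg (+oo%R : set_system R) x x_oo) /\
  (t ^+ 2 * W t @[t --> +oo%R] --> (0 : R)).

Proof.
have Phi_diff u : differentiable Phi u by have [] := Phi_C1.
set m := min_value Phi in W *.
have get_min : argmin Phi (get (argmin Phi)) by exact: getPex.
have Phi_ge u : m <= Phi u := get_min u.
have minP z : argmin Phi z -> m = Phi z.
  by move=> z_min; apply/le_anti; rewrite Phi_ge z_min.
pose grad := gradient ip Phi.
have gradE u h : 'd Phi u h = ip (grad u) h by exact: gradientE.
have Phi_subgrad u v : Phi u + ip (grad u) (v - u) <= Phi v.
  by rewrite -gradE; exact: convex_differential_le.
(* Only times [t > t0] are kept: there the derivatives within [I] are ordinary ones, and the limits
   at infinity are unaffected. *)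
have I_nbhs t : t0 < t -> nbhs t I.
  by move=> t0t; apply: filterS (lt_nbhsr t0t) => s /ltW.
have [x_deriv x'_deriv _] := x_C2.
have x_dx t : t0 < t -> is_derive t 1 x (x' t).
  by move=> t0t; apply: is_derive_in; [exact: I_nbhs|exact/x_deriv/ltW].
have dx_ddx t : t0 < t -> is_derive t 1 x' (x'' t).
  by move=> t0t; apply: is_derive_in; [exact: I_nbhs|exact/x'_deriv/ltW].
have Phi_x t : t0 < t ->
    is_derive t 1 (fun s => Phi (x s) : R) (ip (grad (x t)) (x' t)).
  by move=> t0t; rewrite -gradE; exact: is_derive_comp_diff (x_dx _ t0t).
have sol t : t0 < t -> x'' t + (K / t) *: x' t + grad (x t) = 0.
  by move=> /ltW; exact: x_sol.
split; last first.
  exact: (mech_energy_cvg ip ip_norm Phi grad m K t0 x x' x''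
    Phi_ge Phi_subgrad K_gt3 t0_gt0 x_dx dx_ddx Phi_x sol _
    (minP _ get_min)).
(* Opial with [S = argmin Phi]: distances to minimizers converge, and weak limits along finer
   ultrafilters minimize because [Phi (x t)] tends to [m]. *)
apply: (opial ip ip_norm _ x (argmin Phi)) => // [z z_min|U z UU FU xz u].
  exact: (dist_minimizer_is_cvg ip ip_norm Phi grad m K t0 x x' x''
    Phi_ge Phi_subgrad K_gt3 t0_gt0 x_dx dx_ddx Phi_x sol _
    (minP _ z_min)).
apply: le_trans (Phi_ge u).
apply: (weak_limit_minimizer ip Phi grad m _ U x z) => //.
apply: cvg_trans; first exact: cvg_app FU.
exact: (Phi_cvg ip ip_norm Phi grad m K t0 x x' x''
    Phi_ge Phi_subgrad K_gt3 t0_gt0 x_dx dx_ddx Phi_x sol _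
    (minP _ get_min)).
Qed.
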